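(* Let $\mathfrak{g}$ be a finite-dimensional real Lie algebra, let $R=1\otimes1+\hbar r+\cdots$ be a formal universal $R$-matrix for $\mathfrak{g}$, and let $\star$ be a star product on a manifold $M$ which is quasi-commutative with respect to $R$. Then the Poisson structure quantized by $\star$ is induced by the $r$-matrix $r$ corresponding to $R$, i.e. $$\{f,g\}=m(r\triangleright(f\otimes g))\qquad\text{for all } f,g\in C^\infty(M),$$ where $m$ is the pointwise multiplication and $\triangleright$ is the action occurring in the quasi-commutativity condition.
   Context: $\mathcal{U}(\mathfrak{g})[[\hbar]]$ carries the $\hbar$-linear extension of the standard Hopf algebra structure of the universal enveloping algebra, with coproduct $\Delta$ and opposite coproduct $\Delta^{\mathrm{opp}}$. Formal universal $R$-matrix for $\mathfrak{g}$: an invertible element $R\in(\mathcal{U}(\mathfrak{g})\otimes\mathcal{U}(\mathfrak{g}))[[\hbar]]$, written $R=R_1\otimes R_2$ in Sweedler notation, such that $R=1\otimes1+\cdots$ (higher orders in $\hbar$), $\Delta^{\mathrm{opp}}=R\Delta R^{-1}$, $(\mathrm{id}\otimes\Delta)R=(R_1\otimes1\otimes R_2)(R\otimes1)$ and $(\Delta\otimes\mathrm{id})R=(R_1\otimes1\otimes R_2)(1\otimes R)$. The $r$-matrix corresponding to $R$ is the first-order term $r$ in $R=1\otimes1+\hbar r+\cdots$. Star product: an associative $\mathbb{R}[[\hbar]]$-bilinear product on $C^\infty(M)[[\hbar]]$ of the form $f\star g=fg+\sum_{k\ge1}\hbar^kC_k(f,g)$ with bidifferential operators $C_k$ and with unit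 $1$; it quantizes the Poisson bracket $\{f,g\}=C_1(f,g)-C_1(g,f)$. Quasi-commutative: $\star$ is quasi-commutative with respect to $R$ if there is an action of $\mathfrak{g}$ on $C^\infty(M)$ by derivations (a Lie algebra homomorphism $\mathfrak{g}\to\Gamma^\infty(TM)$) such that its extension $\triangleright$ to an action of $\mathcal{U}(\mathfrak{g})[[\hbar]]$ on $C^\infty(M)[[\hbar]]$ satisfies $f\star g=(R_2\triangleright g)\star(R_1\triangleright f)$ for all $f,g\in C^\infty(M)[[\hbar]]$. *)

(* Defs.v *)
From HB Require Import structures.
From mathcomp Require Import all_boot all_order all_algebra generic_quotient.
From mathcomp Require Import all_classical all_reals all_analysis.

Set Implicit Arguments.
Unset Strict Implicit.
Unset Printing Implicit Defensive.

Import Order.TTheory GRing.Theory Num.Theory.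
Import numFieldNormedType.Exports.

Local Open Scope classical_set_scope.
Local Open Scope ring_scope.
Local Open Scope quotient_scope.

(* Augmented algebras: algebras with a character to the ground ring.  For the
   algebras below it is the Hopf counit, and it witnesses 1 != 0. *)
HB.mixin Record Algebra_isAugmented (K : comNzRingType) A
    of GRing.Algebra K A := {
  counit : A -> K;
  counit_linear : linear_for *%R counit;
  counit1 : counit 1 = 1;
  counitM : {morph counit : x y / x * y}
}.

#[short(type="augAlgType")]
HB.structure Definition AugmentedAlgebra (K : comNzRingType) :=
  {A of GRing.Algebra K A & Algebra_isAugmented K A}.

HB.mixin Record Lmodule_isLieAlgebra (K : comNzRingType) g
    of GRing.Lmodule K g := {
  lie : g -> g -> g;
  lie_linearl : forall y, linear (lie^~ y);
  lie_linearr : forall x, linear (lie x);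
  lie_alternating : forall x, lie x x = 0;
  lie_jacobi : forall x y z,
    lie x (lie y z) + lie y (lie z x) + lie z (lie x y) = 0
}.

#[short(type="lieAlgType")]
HB.structure Definition LieAlgebra (K : comNzRingType) :=
  {g of GRing.Lmodule K g & Lmodule_isLieAlgebra K g}.

#[short(type="fdLieAlgType")]
HB.structure Definition FinDimLieAlgebra (K : comNzRingType) :=
  {g of LieAlgebra K g & Vector K g}.

(* The tensor product of V and W: formal linear combinations of symbols
   v (x) w, modulo the congruence generated by the module axioms and by
   bilinearity. *)
Section Tensor.
Variables (K : comNzRingType) (V W : lmodType K).

Inductive tterm :=
  | TZero | TAdd of tterm & tterm | TScale of K & tterm | TPure of V & W.

Inductive tcong : tterm -> tterm -> Prop :=
  | tcong_refl s : tcong s s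
  | tcong_sym s t : tcong s t -> tcong t s
  | tcong_trans s t u : tcong s t -> tcong t u -> tcong s u
  | tcong_add s s' t t' :
      tcong s s' -> tcong t t' -> tcong (TAdd s t) (TAdd s' t')
  | tcong_scale k s s' : tcong s s' -> tcong (TScale k s) (TScale k s')
  | tcong_addA s t u : tcong (TAdd s (TAdd t u)) (TAdd (TAdd s t) u)
  | tcong_addC s t : tcong (TAdd s t) (TAdd t s)
  | tcong_add0 s : tcong (TAdd TZero s) s
  | tcong_scale0 s : tcong (TScale 0 s) TZero
  | tcong_scale1 s : tcong (TScale 1 s) s
  | tcong_scaleA k l s : tcong (TScale k (TScale l s)) (TScale (k * l) s)
  | tcong_scaleDr k s t :
      tcong (TScale k (TAdd s t)) (TAdd (TScale k s) (TScale k t))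
  | tcong_scaleDl k l s :
      tcong (TScale (k + l) s) (TAdd (TScale k s) (TScale l s))
  | tcong_pureDl v v' w :
      tcong (TPure (v + v') w) (TAdd (TPure v w) (TPure v' w))
  | tcong_pureDr v w w' :
      tcong (TPure v (w + w')) (TAdd (TPure v w) (TPure v w'))
  | tcong_pureZl k v w : tcong (TPure (k *: v) w) (TScale k (TPure v w))
  | tcong_pureZr k v w : tcong (TPure v (k *: w)) (TScale k (TPure v w)).

HB.instance Definition _ := gen_eqMixin tterm.
HB.instance Definition _ := gen_choiceMixin tterm.

Definition tcongb s t := `[<tcong s t>].

Lemma tcongb_refl : reflexive tcongb.
Proof. by move=> s; apply/asboolP; exact: tcong_refl. Qed.

Lemma tcongb_sym : symmetric tcongb.
Proof. by move=> s t; apply/asboolP/asboolP; exact: tcong_sym. Qed.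

Lemma tcongb_trans : transitive tcongb.
Proof.
move=> t s u /asboolP st /asboolP tu; apply/asboolP; exact: tcong_trans st tu.
Qed.

Definition tcong_equiv := EquivRel tcongb tcongb_refl tcongb_sym tcongb_trans.

Definition tensor := {eq_quot tcong_equiv}.

HB.instance Definition _ := Choice.on tensor.

Definition tpi (t : tterm) : tensor := \pi_tensor t.

Lemma tpi_eq s t : tcong s t -> tpi s = tpi t.
Proof. by move=> st; apply/eqmodP/asboolP. Qed.

Lemma tpi_repr (x : tensor) : tpi (repr x) = x.
Proof. exact: reprK. Qed.

Lemma repr_tpi t : tcong (repr (tpi t)) t.
Proof. by apply/asboolP/(eqmodP tcong_equiv); exact: reprK. Qed.

Lemma tensorW (P : tensor -> Prop) : (forall t, P (tpi t)) -> forall x, P x.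
Proof. by move=> H x; rewrite -(tpi_repr x). Qed.

Definition tens (v : V) (w : W) : tensor := tpi (TPure v w).

Definition tzero : tensor := tpi TZero.
Definition tadd (x y : tensor) : tensor := tpi (TAdd (repr x) (repr y)).
Definition tscale k (x : tensor) : tensor := tpi (TScale k (repr x)).
Definition topp (x : tensor) : tensor := tscale (-1) x.

Lemma taddE s t : tadd (tpi s) (tpi t) = tpi (TAdd s t).
Proof. by apply/tpi_eq/tcong_add; exact: repr_tpi. Qed.

Lemma tscaleE k t : tscale k (tpi t) = tpi (TScale k t).
Proof. by apply/tpi_eq/tcong_scale; exact: repr_tpi. Qed.

Lemma taddA : associative tadd.
Proof.
elim/tensorW=> s; elim/tensorW=> t; elim/tensorW=> u.
by rewrite !taddE; apply/tpi_eq/tcong_addA.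
Qed.

Lemma taddC : commutative tadd.
Proof.
by elim/tensorW=> s; elim/tensorW=> t; rewrite !taddE; apply/tpi_eq/tcong_addC.
Qed.

Lemma tadd0 : left_id tzero tadd.
Proof. by elim/tensorW=> s; rewrite taddE; apply/tpi_eq/tcong_add0. Qed.

Lemma taddN : left_inverse tzero topp tadd.
Proof.
elim/tensorW=> s; rewrite /topp tscaleE taddE; apply/tpi_eq.
apply: tcong_trans (tcong_scale0 s).
rewrite -(addNr 1); apply: tcong_sym.
apply: tcong_trans (tcong_scaleDl _ _ _) _.
by apply: tcong_add; [exact: tcong_refl | exact: tcong_scale1].
Qed.

HB.instance Definition _ :=
  GRing.isZmodule.Build tensor taddA taddC tadd0 taddN.

Lemma tscaleA k l x : tscale k (tscale l x) = tscale (k * l) x.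
Proof.
by elim/tensorW: x => s; rewrite !tscaleE; apply/tpi_eq/tcong_scaleA.
Qed.

Lemma tscale1 : left_id 1 tscale.
Proof. by elim/tensorW=> s; rewrite tscaleE; apply/tpi_eq/tcong_scale1. Qed.

Lemma tscaleDr : right_distributive tscale +%R.
Proof.
move=> k; elim/tensorW=> s; elim/tensorW=> t.
by rewrite /GRing.add /= taddE !tscaleE taddE; apply/tpi_eq/tcong_scaleDr.
Qed.

Lemma tscaleDl x : {morph tscale^~ x : k l / k + l}.
Proof.
elim/tensorW: x => s k l.
by rewrite [in RHS]/GRing.add /= !tscaleE taddE; apply/tpi_eq/tcong_scaleDl.
Qed.

HB.instance Definition _ :=
  GRing.Zmodule_isLmodule.Build K tensor tscaleA tscale1 tscaleDr tscaleDl.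

Lemma tpiD s t : tpi (TAdd s t) = tpi s + tpi t.
Proof. by rewrite -taddE. Qed.

Lemma tpiZ k s : tpi (TScale k s) = k *: tpi s.
Proof. by rewrite -tscaleE. Qed.

Lemma tensor_ind (P : tensor -> Prop) :
  P 0 -> (forall x y, P x -> P y -> P (x + y)) ->
  (forall k x, P x -> P (k *: x)) -> (forall v w, P (tens v w)) ->
  forall x, P x.
Proof.
move=> P0 PD PZ Pt; elim/tensorW; elim=> [|s Ps t Qt|k s Ps|v w].
- exact: P0.
- by rewrite tpiD; exact: PD.
- by rewrite tpiZ; exact: PZ.
- exact: Pt.
Qed.

Lemma tensor_ext (Z : lmodType K) (f g : tensor -> Z) :
  linear f -> linear g -> (forall v w, f (tens v w) = g (tens v w)) -> f =1 g.
Proof.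
move=> lf lg fg; elim/tensor_ind=> [|x y IHx IHy|k x IHx|//].
- have f0 (h : tensor -> Z) : linear h -> h 0 = 0.
    move=> lh; have := lh 1 0 0.
    by rewrite !scale1r addr0 -{1}[h 0]addr0 => /addrI.
  by rewrite !f0.
- by rewrite -[x]scale1r lf lg !scale1r in IHx IHy *; rewrite IHx IHy.
- have f0 (h : tensor -> Z) : linear h -> h 0 = 0.
    move=> lh; have := lh 1 0 0.
    by rewrite !scale1r addr0 -{1}[h 0]addr0 => /addrI.
  by rewrite -[k *: x]addr0 lf lg IHx !f0.
Qed.

Definition bilin (Z : lmodType K) (b : V -> W -> Z) :=
  (forall w, linear (b^~ w)) /\ (forall v, linear (b v)).

Lemma tens_bilin : bilin tens.
Proof.
split=> [w k v v'|v k w w'].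
  rewrite /tens (tpi_eq (tcong_pureDl _ _ _)) tpiD.
  by rewrite (tpi_eq (tcong_pureZl _ _ _)) tpiZ.
rewrite /tens (tpi_eq (tcong_pureDr _ _ _)) tpiD.
by rewrite (tpi_eq (tcong_pureZr _ _ _)) tpiZ.
Qed.

Section Lift.
Variables (Z : lmodType K) (b : V -> W -> Z).

Fixpoint teval (t : tterm) : Z :=
  match t with
  | TZero => 0
  | TAdd s t => teval s + teval t
  | TScale k s => k *: teval s
  | TPure v w => b v w
  end.

(* The linear map sending v (x) w to b v w.  Meaningful only for bilinear b;
   see tlift_tens and tlift_linear. *)
Definition tlift (x : tensor) : Z := teval (repr x).

Hypothesis b_bilin : bilin b.

Lemma teval_cong s t : tcong s t -> teval s = teval t.
Proof.
have [bl br] := b_bilin.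
have bDl v v' w : b (v + v') w = b v w + b v' w.
  by have := bl w 1 v v'; rewrite !scale1r.
have bDr v w w' : b v (w + w') = b v w + b v w'.
  by have := br v 1 w w'; rewrite !scale1r.
have b0l w : b 0 w = 0.
  by have := bDl 0 0 w; rewrite addr0 -{1}[b 0 w]addr0 => /addrI.
have b0r v : b v 0 = 0.
  by have := bDr v 0 0; rewrite addr0 -{1}[b v 0]addr0 => /addrI.
elim=> {s t} //=; try by move=> *; congruence.
- by move=> *; rewrite addrA.
- by move=> *; rewrite addrC.
- by move=> *; rewrite add0r.
- by move=> *; rewrite scale0r.
- by move=> *; rewrite scale1r.
- by move=> *; rewrite scalerA.
- by move=> *; rewrite scalerDr.
- by move=> *; rewrite scalerDl.
- by move=> k v w; have := bl w k v 0; rewrite addr0 b0l addr0.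
- by move=> k v w; have := br v k w 0; rewrite addr0 b0r addr0.
Qed.

Lemma tlift_tpi t : tlift (tpi t) = teval t.
Proof. exact/teval_cong/repr_tpi. Qed.

Lemma tlift_tens v w : tlift (tens v w) = b v w.
Proof. by rewrite tlift_tpi. Qed.

Lemma tlift_linear : linear tlift.
Proof.
move=> k; elim/tensorW=> s; elim/tensorW=> t.
by rewrite -tpiZ -tpiD !tlift_tpi.
Qed.

End Lift.
End Tensor.

Arguments tens {K V W}.

Section TensorAlgebra.
Variables (K : comNzRingType) (A B : augAlgType K).
Local Notation AB := (tensor A B).

Definition tmulr (a' : A) (b' : B) : AB -> AB :=
  tlift (fun a b => tens (a * a') (b * b')).

(* (a (x) b) * (a' (x) b') = (a * a') (x) (b * b') *)
Definition tmul (x y : AB) : AB := tlift (fun a' b' => tmulr a' b' x) y.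

Definition tone : AB := tens 1 1.

Lemma tensDZl k a a' (b : B) :
  tens (k *: a + a') b = k *: tens a b + tens a' b :> AB.
Proof. exact: (tens_bilin A B).1. Qed.

Lemma tensDZr k (a : A) b b' :
  tens a (k *: b + b') = k *: tens a b + tens a b' :> AB.
Proof. exact: (tens_bilin A B).2. Qed.

Lemma tmulr_bilin a' b' :
  bilin (fun a b => tens (a * a') (b * b') : AB).
Proof.
by split=> [w|v] k x y; rewrite mulrDl -scalerAl ?tensDZl ?tensDZr.
Qed.

Lemma tmulr_tens a' b' a b : tmulr a' b' (tens a b) = tens (a * a') (b * b').
Proof. exact/tlift_tens/tmulr_bilin. Qed.

Lemma tmulr_linear a' b' : linear (tmulr a' b').
Proof. exact/tlift_linear/tmulr_bilin. Qed.

Lemma linear_comb (U V : lmodType K) k (f g : U -> V) :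
  linear f -> linear g -> linear (fun x => k *: f x + g x).
Proof.
move=> lf lg l x y; rewrite lf lg !scalerDr !scalerA mulrC.
by rewrite -!addrA; congr (_ + _); rewrite addrCA.
Qed.

Lemma tmul_bilin x : bilin (fun a' b' => tmulr a' b' x).
Proof.
split=> [b' k y y'|a' k y y']; move: x.
  apply: (tensor_ext (f := tmulr (k *: y + y') b')
            (g := fun x => k *: tmulr y b' x + tmulr y' b' x)).
  - exact: tmulr_linear.
  - by apply: linear_comb; exact: tmulr_linear.
  by move=> a b; rewrite !tmulr_tens mulrDr -scalerAr tensDZl.
apply: (tensor_ext (f := tmulr a' (k *: y + y'))
          (g := fun x => k *: tmulr a' y x + tmulr a' y' x)).
- exact: tmulr_linear.
- by apply: linear_comb; exact: tmulr_linear.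
by move=> a b; rewrite !tmulr_tens mulrDr -scalerAr tensDZr.
Qed.

Lemma tmul_tens a b a' b' :
  tmul (tens a b) (tens a' b') = tens (a * a') (b * b').
Proof. by rewrite /tmul tlift_tens ?tmulr_tens //; exact: tmul_bilin. Qed.

Lemma tmul_linearr x : linear (tmul x).
Proof. exact/tlift_linear/tmul_bilin. Qed.

Lemma tmul_linearl y : linear (tmul^~ y).
Proof.
move=> k x x'; move: y.
apply: (tensor_ext (f := tmul (k *: x + x'))
          (g := fun y => k *: tmul x y + tmul x' y)).
- exact: tmul_linearr.
- by apply: linear_comb; exact: tmul_linearr.
move=> a b; rewrite /tmul !tlift_tens; do ?exact: tmul_bilin.
exact: tmulr_linear.
Qed.

Lemma tmulDZl k x x' y : tmul (k *: x + x') y = k *: tmul x y + tmul x' y.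
Proof. exact: tmul_linearl. Qed.

Lemma tmulDZr k x y y' : tmul x (k *: y + y') = k *: tmul x y + tmul x y'.
Proof. exact: tmul_linearr. Qed.

Lemma tmulA : associative tmul.
Proof.
move=> x y z; move: x.
apply: (tensor_ext (f := fun x => tmul x (tmul y z))
                   (g := fun x => tmul (tmul x y) z)).
- by move=> k u v; rewrite tmulDZl.
- by move=> k u v; rewrite !tmulDZl.
move=> a b; move: y.
apply: (tensor_ext (f := fun y => tmul (tens a b) (tmul y z))
                   (g := fun y => tmul (tmul (tens a b) y) z)).
- by move=> k u v; rewrite tmulDZl tmulDZr.
- by move=> k u v; rewrite tmulDZr tmulDZl.
move=> a' b'; move: z.
apply: (tensor_ext (f := fun z => tmul (tens a b) (tmul (tens a' b') z))
                   (g := tmul (tmul (tens a b) (tens a' b')))).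
- by move=> k u v; rewrite !tmulDZr.
- exact: tmul_linearr.
by move=> a'' b''; rewrite !tmul_tens !mulrA.
Qed.

Lemma tmul1 : left_id tone tmul.
Proof.
apply: (tensor_ext (f := tmul tone) (g := id)) => [||a b].
- exact: tmul_linearr.
- by [].
- by rewrite tmul_tens !mul1r.
Qed.

Lemma tmulr1 : right_id tone tmul.
Proof.
apply: (tensor_ext (f := tmul^~ tone) (g := id)) => [||a b].
- exact: tmul_linearl.
- by [].
- by rewrite tmul_tens !mulr1.
Qed.

Lemma tmulDl : left_distributive tmul +%R.
Proof. by move=> x y z; have := tmul_linearl z 1 x y; rewrite !scale1r. Qed.

Lemma tmulDr : right_distributive tmul +%R.
Proof. by move=> x y z; have := tmul_linearr x 1 y z; rewrite !scale1r. Qed.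

HB.instance Definition _ :=
  GRing.Zmodule_isPzRing.Build (tensor A B) tmulA tmul1 tmulr1 tmulDl tmulDr.

Definition tcounit (x : AB) : K :=
  tlift (Z := K^o) (fun a b => counit a * counit b) x.

Lemma tcounit_bilin :
  bilin (Z := K^o) (fun (a : A) (b : B) => counit a * counit b).
Proof.
split=> [b|a] k x y; rewrite counit_linear.
  by rewrite mulrDl -mulrA.
by rewrite mulrDr mulrCA.
Qed.

Lemma tcounit_linear : linear_for *%R tcounit.
Proof. exact: (tlift_linear (Z := K^o) tcounit_bilin). Qed.

Lemma tcounit_tens a b : tcounit (tens a b) = counit a * counit b.
Proof. exact: (tlift_tens (Z := K^o) tcounit_bilin). Qed.

Lemma tcounit1 : tcounit 1 = 1.
Proof. by rewrite tcounit_tens !counit1 mulr1. Qed.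

Lemma tone_neq0 : (1 : AB) != 0.
Proof.
apply/eqP => e; have := tcounit_linear 1 0 0.
rewrite scale1r addr0 mul1r -{1}[tcounit 0]addr0 => /addrI.
by rewrite -e tcounit1 => /eqP; rewrite eq_sym oner_eq0.
Qed.

HB.instance Definition _ :=
  GRing.PzSemiRing_isNonZero.Build (tensor A B) tone_neq0.

Lemma tscalerAl (k : K) (x y : AB) : k *: (x * y) = (k *: x) * y.
Proof.
rewrite -[k *: x]addr0 -[RHS]/(tmul (k *: x + 0) y) tmulDZl.
by rewrite -[tmul 0 y]/(0 * y) mul0r addr0.
Qed.

HB.instance Definition _ :=
  GRing.LSemiModule_isLSemiAlgebra.Build K (tensor A B) tscalerAl.

Lemma tscalerAr (k : K) (x y : AB) : k *: (x * y) = x * (k *: y).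
Proof.
rewrite -[k *: y]addr0 -[RHS]/(tmul x (k *: y + 0)) tmulDZr.
by rewrite -[tmul x 0]/(x * 0) mulr0 addr0.
Qed.

HB.instance Definition _ :=
  GRing.LSemiAlgebra_isSemiAlgebra.Build K (tensor A B) tscalerAr.

Lemma tcounitM : {morph tcounit : x y / x * y}.
Proof.
move=> x y; move: x.
apply: (tensor_ext (Z := K^o) (f := fun x => tcounit (x * y))
                   (g := fun x => tcounit x * tcounit y)).
- by move=> k x x'; rewrite mulrDl -scalerAl tcounit_linear.
- by move=> k x x'; rewrite tcounit_linear mulrDl -mulrA.
move=> a b; move: y.
apply: (tensor_ext (Z := K^o) (f := fun y => tcounit (tens a b * y))
                   (g := fun y => tcounit (tens a b) * tcounit y)).
- by move=> k y y'; rewrite mulrDr -scalerAr tcounit_linear.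
- by move=> k y y'; rewrite tcounit_linear mulrDr mulrCA.
move=> a' b'.
rewrite [tens a b * _]tmul_tens !tcounit_tens !counitM -!mulrA.
by congr (_ * _); rewrite mulrCA.
Qed.

HB.instance Definition _ :=
  Algebra_isAugmented.Build K (tensor A B) tcounit_linear tcounit1 tcounitM.

End TensorAlgebra.

(* The universal enveloping algebra of g: noncommutative polynomial expressions
   in the elements of g, modulo the congruence generated by the axioms of
   associative unital K-algebras, by the linearity of g -> U(g), and by
   x * y - y * x = [x, y]. *)
Section Enveloping.
Variables (K : comNzRingType) (g : lieAlgType K).

Inductive uterm :=
  | UVar of g | UZero | UOne | UAdd of uterm & uterm | UScale of K & uterm
  | UMul of uterm & uterm.

Inductive ucong : uterm -> uterm -> Prop :=
  | ucong_refl s : ucong s s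
  | ucong_sym s t : ucong s t -> ucong t s
  | ucong_trans s t u : ucong s t -> ucong t u -> ucong s u
  | ucong_add s s' t t' :
      ucong s s' -> ucong t t' -> ucong (UAdd s t) (UAdd s' t')
  | ucong_scale k s s' : ucong s s' -> ucong (UScale k s) (UScale k s')
  | ucong_mul s s' t t' :
      ucong s s' -> ucong t t' -> ucong (UMul s t) (UMul s' t')
  | ucong_addA s t u : ucong (UAdd s (UAdd t u)) (UAdd (UAdd s t) u)
  | ucong_addC s t : ucong (UAdd s t) (UAdd t s)
  | ucong_add0 s : ucong (UAdd UZero s) s
  | ucong_scale0 s : ucong (UScale 0 s) UZero
  | ucong_scale1 s : ucong (UScale 1 s) s
  | ucong_scaleA k l s : ucong (UScale k (UScale l s)) (UScale (k * l) s)
  | ucong_scaleDr k s t :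
      ucong (UScale k (UAdd s t)) (UAdd (UScale k s) (UScale k t))
  | ucong_scaleDl k l s :
      ucong (UScale (k + l) s) (UAdd (UScale k s) (UScale l s))
  | ucong_mulA s t u : ucong (UMul s (UMul t u)) (UMul (UMul s t) u)
  | ucong_mul1 s : ucong (UMul UOne s) s
  | ucong_mulr1 s : ucong (UMul s UOne) s
  | ucong_mulDl s t u : ucong (UMul (UAdd s t) u) (UAdd (UMul s u) (UMul t u))
  | ucong_mulDr s t u : ucong (UMul s (UAdd t u)) (UAdd (UMul s t) (UMul s u))
  | ucong_scaleAl k s t : ucong (UScale k (UMul s t)) (UMul (UScale k s) t)
  | ucong_scaleAr k s t : ucong (UScale k (UMul s t)) (UMul s (UScale k t))
  | ucong_varD x y : ucong (UVar (x + y)) (UAdd (UVar x) (UVar y))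
  | ucong_varZ k x : ucong (UVar (k *: x)) (UScale k (UVar x))
  | ucong_lie x y :
      ucong (UMul (UVar x) (UVar y))
            (UAdd (UMul (UVar y) (UVar x)) (UVar (lie x y))).

HB.instance Definition _ := gen_eqMixin uterm.
HB.instance Definition _ := gen_choiceMixin uterm.

Definition ucongb s t := `[<ucong s t>].

Lemma ucongb_refl : reflexive ucongb.
Proof. by move=> s; apply/asboolP; exact: ucong_refl. Qed.

Lemma ucongb_sym : symmetric ucongb.
Proof. by move=> s t; apply/asboolP/asboolP; exact: ucong_sym. Qed.

Lemma ucongb_trans : transitive ucongb.
Proof.
move=> t s u /asboolP st /asboolP tu; apply/asboolP; exact: ucong_trans st tu.
Qed.

Definition ucong_equiv := EquivRel ucongb ucongb_refl ucongb_sym ucongb_trans.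

Definition env := {eq_quot ucong_equiv}.

HB.instance Definition _ := Choice.on env.

Definition upi (t : uterm) : env := \pi_env t.

Lemma upi_eq s t : ucong s t -> upi s = upi t.
Proof. by move=> st; apply/eqmodP/asboolP. Qed.

Lemma upi_repr (x : env) : upi (repr x) = x.
Proof. exact: reprK. Qed.

Lemma repr_upi t : ucong (repr (upi t)) t.
Proof. by apply/asboolP/(eqmodP ucong_equiv); exact: reprK. Qed.

Lemma envW (P : env -> Prop) : (forall t, P (upi t)) -> forall x, P x.
Proof. by move=> H x; rewrite -(upi_repr x). Qed.

Definition ui (x : g) : env := upi (UVar x).

Definition uzero : env := upi UZero.
Definition uone : env := upi UOne.
Definition uadd (x y : env) : env := upi (UAdd (repr x) (repr y)).
Definition uscale k (x : env) : env := upi (UScale k (repr x)).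
Definition umul (x y : env) : env := upi (UMul (repr x) (repr y)).
Definition uopp (x : env) : env := uscale (-1) x.

Lemma uaddE s t : uadd (upi s) (upi t) = upi (UAdd s t).
Proof. by apply/upi_eq/ucong_add; exact: repr_upi. Qed.

Lemma uscaleE k t : uscale k (upi t) = upi (UScale k t).
Proof. by apply/upi_eq/ucong_scale; exact: repr_upi. Qed.

Lemma umulE s t : umul (upi s) (upi t) = upi (UMul s t).
Proof. by apply/upi_eq/ucong_mul; exact: repr_upi. Qed.

Lemma uaddA : associative uadd.
Proof.
elim/envW=> s; elim/envW=> t; elim/envW=> u.
by rewrite !uaddE; apply/upi_eq/ucong_addA.
Qed.

Lemma uaddC : commutative uadd.
Proof.
by elim/envW=> s; elim/envW=> t; rewrite !uaddE; apply/upi_eq/ucong_addC.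
Qed.

Lemma uadd0 : left_id uzero uadd.
Proof. by elim/envW=> s; rewrite uaddE; apply/upi_eq/ucong_add0. Qed.

Lemma uaddN : left_inverse uzero uopp uadd.
Proof.
elim/envW=> s; rewrite /uopp uscaleE uaddE; apply/upi_eq.
apply: ucong_trans (ucong_scale0 s).
rewrite -(addNr 1); apply: ucong_sym.
apply: ucong_trans (ucong_scaleDl _ _ _) _.
by apply: ucong_add; [exact: ucong_refl | exact: ucong_scale1].
Qed.

HB.instance Definition _ := GRing.isZmodule.Build env uaddA uaddC uadd0 uaddN.

Lemma uscaleA k l x : uscale k (uscale l x) = uscale (k * l) x.
Proof. by elim/envW: x => s; rewrite !uscaleE; apply/upi_eq/ucong_scaleA. Qed.

Lemma uscale1 : left_id 1 uscale.
Proof. by elim/envW=> s; rewrite uscaleE; apply/upi_eq/ucong_scale1. Qed.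

Lemma uscaleDr : right_distributive uscale +%R.
Proof.
move=> k; elim/envW=> s; elim/envW=> t.
by rewrite /GRing.add /= uaddE !uscaleE uaddE; apply/upi_eq/ucong_scaleDr.
Qed.

Lemma uscaleDl x : {morph uscale^~ x : k l / k + l}.
Proof.
elim/envW: x => s k l.
by rewrite [in RHS]/GRing.add /= !uscaleE uaddE; apply/upi_eq/ucong_scaleDl.
Qed.

HB.instance Definition _ :=
  GRing.Zmodule_isLmodule.Build K env uscaleA uscale1 uscaleDr uscaleDl.

Lemma umulA : associative umul.
Proof.
elim/envW=> s; elim/envW=> t; elim/envW=> u.
by rewrite !umulE; apply/upi_eq/ucong_mulA.
Qed.

Lemma umul1 : left_id uone umul.
Proof. by elim/envW=> s; rewrite umulE; apply/upi_eq/ucong_mul1. Qed.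

Lemma umulr1 : right_id uone umul.
Proof. by elim/envW=> s; rewrite umulE; apply/upi_eq/ucong_mulr1. Qed.

Lemma umulDl : left_distributive umul +%R.
Proof.
elim/envW=> s; elim/envW=> t; elim/envW=> u.
by rewrite /GRing.add /= uaddE !umulE uaddE; apply/upi_eq/ucong_mulDl.
Qed.

Lemma umulDr : right_distributive umul +%R.
Proof.
elim/envW=> s; elim/envW=> t; elim/envW=> u.
by rewrite /GRing.add /= uaddE !umulE uaddE; apply/upi_eq/ucong_mulDr.
Qed.

HB.instance Definition _ :=
  GRing.Zmodule_isPzRing.Build env umulA umul1 umulr1 umulDl umulDr.

Lemma upiD s t : upi (UAdd s t) = upi s + upi t.
Proof. by rewrite -uaddE. Qed.

Lemma upiZ k s : upi (UScale k s) = k *: upi s.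
Proof. by rewrite -uscaleE. Qed.

Lemma upiM s t : upi (UMul s t) = upi s * upi t.
Proof. by rewrite -umulE. Qed.

Lemma ui_linear : linear ui.
Proof.
move=> k x y; rewrite /ui (upi_eq (ucong_varD _ _)) upiD.
by rewrite (upi_eq (ucong_varZ _ _)) upiZ.
Qed.

Lemma ui_lie x y : ui (lie x y) = ui x * ui y - ui y * ui x.
Proof.
by rewrite /ui -!upiM (upi_eq (ucong_lie x y)) upiD addrAC subrr add0r.
Qed.

Section Lift.
Variables (A : algType K) (f : g -> A).

Fixpoint ueval (t : uterm) : A :=
  match t with
  | UVar x => f x
  | UZero => 0
  | UOne => 1
  | UAdd s t => ueval s + ueval t
  | UScale k s => k *: ueval s
  | UMul s t => ueval s * ueval t
  end.

(* The algebra morphism extending f.  Meaningful only for a Lie algebra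
   morphism f; see ulift_ui, ulift_linear, ulift1 and uliftM. *)
Definition ulift (u : env) : A := ueval (repr u).

Hypothesis f_linear : linear f.
Hypothesis f_lie : forall x y, f (lie x y) = f x * f y - f y * f x.

Lemma ueval_cong s t : ucong s t -> ueval s = ueval t.
Proof.
have fD x y : f (x + y) = f x + f y.
  by have := f_linear 1 x y; rewrite !scale1r.
have f0 : f 0 = 0 by have := fD 0 0; rewrite addr0 -{1}[f 0]addr0 => /addrI.
elim=> {s t} //=; try by move=> *; congruence.
- by move=> *; rewrite addrA.
- by move=> *; rewrite addrC.
- by move=> *; rewrite add0r.
- by move=> *; rewrite scale0r.
- by move=> *; rewrite scale1r.
- by move=> *; rewrite scalerA.
- by move=> *; rewrite scalerDr.
- by move=> *; rewrite scalerDl.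
- by move=> *; rewrite mulrA.
- by move=> *; rewrite mul1r.
- by move=> *; rewrite mulr1.
- by move=> *; rewrite mulrDl.
- by move=> *; rewrite mulrDr.
- by move=> *; rewrite scalerAl.
- by move=> *; rewrite scalerAr.
- by move=> k x; have := f_linear k x 0; rewrite addr0 f0 addr0.
- by move=> x y; rewrite f_lie addrC subrK.
Qed.

Lemma ulift_upi t : ulift (upi t) = ueval t.
Proof. exact/ueval_cong/repr_upi. Qed.

Lemma ulift_ui x : ulift (ui x) = f x.
Proof. by rewrite ulift_upi. Qed.

Lemma ulift_linear : linear ulift.
Proof.
move=> k; elim/envW=> s; elim/envW=> t.
by rewrite -upiZ -upiD !ulift_upi.
Qed.

Lemma ulift1 : ulift 1 = 1.
Proof. by rewrite ulift_upi. Qed.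

Lemma uliftM : {morph ulift : x y / x * y}.
Proof.
by elim/envW=> s; elim/envW=> t; rewrite -upiM !ulift_upi.
Qed.

End Lift.

Definition ucounit (u : env) : K := ulift (A := K^o) (fun _ => 0) u.

Lemma ucounit_subproof1 : linear (fun _ : g => 0 : K^o).
Proof. by move=> k x y; rewrite addr0 scaler0. Qed.

Lemma ucounit_subproof2 (x y : g) : 0 = 0 * 0 - 0 * 0 :> K^o.
Proof. by rewrite mulr0 subrr. Qed.

Lemma ucounit_linear : linear_for *%R ucounit.
Proof. exact: (ulift_linear ucounit_subproof1 ucounit_subproof2). Qed.

Lemma ucounit1 : ucounit 1 = 1.
Proof. exact: (ulift1 ucounit_subproof1 ucounit_subproof2). Qed.

Lemma ucounitM : {morph ucounit : x y / x * y}.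
Proof. exact: (uliftM ucounit_subproof1 ucounit_subproof2). Qed.

Lemma uone_neq0 : (1 : env) != 0.
Proof.
apply/eqP => e; have := ucounit_linear 1 0 0.
rewrite scale1r addr0 mul1r -{1}[ucounit 0]addr0 => /addrI.
by rewrite -e ucounit1 => /eqP; rewrite eq_sym oner_eq0.
Qed.

HB.instance Definition _ := GRing.PzSemiRing_isNonZero.Build env uone_neq0.

Lemma uscalerAl (k : K) (x y : env) : k *: (x * y) = (k *: x) * y.
Proof.
elim/envW: x => s; elim/envW: y => t.
rewrite -!(upiZ, upiM).
exact/upi_eq/ucong_scaleAl.
Qed.

HB.instance Definition _ :=
  GRing.LSemiModule_isLSemiAlgebra.Build K env uscalerAl.

Lemma uscalerAr (k : K) (x y : env) : k *: (x * y) = x * (k *: y).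
Proof.
elim/envW: x => s; elim/envW: y => t.
rewrite -!(upiZ, upiM).
exact/upi_eq/ucong_scaleAr.
Qed.

HB.instance Definition _ :=
  GRing.LSemiAlgebra_isSemiAlgebra.Build K env uscalerAr.

HB.instance Definition _ :=
  Algebra_isAugmented.Build K env ucounit_linear ucounit1 ucounitM.

End Enveloping.

(* The extension to U(g) of a representation rho of g on V, meaningful only
   when rho is one; see uact_ui, uact_linearl, uact_linearr, uact1, uactM. *)
Section Action.
Variables (K : comNzRingType) (g : lieAlgType K) (V : lmodType K).
Variable rho : g -> V -> V.

Record lie_rep : Prop := LieRep {
  lie_rep_linearl : forall v, linear (rho^~ v);
  lie_rep_linearr : forall x, linear (rho x);
  lie_rep_lie : forall x y v,
    rho (lie x y) v = rho x (rho y v) - rho y (rho x v)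
}.

Fixpoint uteract (t : uterm g) (v : V) : V :=
  match t with
  | UVar x => rho x v
  | UZero => 0
  | UOne => v
  | UAdd s t => uteract s v + uteract t v
  | UScale k s => k *: uteract s v
  | UMul s t => uteract s (uteract t v)
  end.

Definition uact (u : env g) (v : V) : V := uteract (repr u) v.

Hypothesis rho_rep : lie_rep.

Lemma uteract_linear t : linear (uteract t).
Proof.
elim: t => [x|||s IHs t IHt|l s IHs|s IHs t IHt] k v w /=.
- exact: lie_rep_linearr.
- by rewrite scaler0 addr0.
- by [].
- by rewrite IHs IHt scalerDr -!addrA; congr (_ + _); rewrite addrCA.
- by rewrite IHs scalerDr !scalerA mulrC.
- by rewrite IHt IHs.
Qed.

Lemma uteract_cong s t : ucong s t -> uteract s =1 uteract t.
Proof.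
have rD v x y : rho (x + y) v = rho x v + rho y v.
  by have := lie_rep_linearl rho_rep v 1 x y; rewrite !scale1r.
have r0 v : rho 0 v = 0.
  by have := rD v 0 0; rewrite addr0 -{1}[rho 0 v]addr0 => /addrI.
have uD t' v w : uteract t' (v + w) = uteract t' v + uteract t' w.
  by have := uteract_linear t' 1 v w; rewrite !scale1r.
have u0 t' : uteract t' 0 = 0.
  by have := uD t' 0 0; rewrite addr0 -{1}[uteract t' 0]addr0 => /addrI.
elim=> {s t} //=.
- by move=> s t _ IH v; rewrite IH.
- by move=> s t u _ IH1 _ IH2 v; rewrite IH1.
- by move=> s s' t t' _ IH1 _ IH2 v; rewrite IH1 IH2.
- by move=> k s s' _ IH v; rewrite IH.
- by move=> s s' t t' _ IH1 _ IH2 v; rewrite IH2 IH1.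
- by move=> s t u v; rewrite addrA.
- by move=> s t v; rewrite addrC.
- by move=> s v; rewrite add0r.
- by move=> s v; rewrite scale0r.
- by move=> s v; rewrite scale1r.
- by move=> k l s v; rewrite scalerA.
- by move=> k s t v; rewrite scalerDr.
- by move=> k l s v; rewrite scalerDl.
- by move=> s t u v; rewrite uD.
- by move=> k s t v; have := uteract_linear s k (uteract t v) 0;
    rewrite !addr0 u0 addr0.
- by move=> x y v; rewrite rD.
- by move=> k x v; have := lie_rep_linearl rho_rep v k x 0;
    rewrite addr0 r0 addr0.
- by move=> x y v; rewrite (lie_rep_lie rho_rep) addrC subrK.
Qed.

Lemma uact_upi t : uact (upi t) =1 uteract t.
Proof. exact/uteract_cong/repr_upi. Qed.

Lemma uact_ui x : uact (ui x) =1 rho x.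
Proof. exact: uact_upi. Qed.

Lemma uact_linearl v : linear (uact^~ v).
Proof.
move=> k; elim/envW=> s; elim/envW=> t.
by rewrite -upiZ -upiD !uact_upi.
Qed.

Lemma uact_linearr u : linear (uact u).
Proof. exact: uteract_linear. Qed.

Lemma uact1 : uact 1 =1 id.
Proof. exact: uact_upi. Qed.

Lemma uactM x y : uact (x * y) =1 uact x \o uact y.
Proof.
by elim/envW: x => s; elim/envW: y => t v; rewrite -upiM /= !uact_upi.
Qed.

End Action.

Section SmoothEuclidean.
Variables (R : realType) (n : nat).
Implicit Types (O : set 'rV[R]_n).

Definition partial (W : normedModType R) (i : 'I_n) (f : 'rV[R]_n -> W) :
  'rV[R]_n -> W := fun x => 'D_(delta_mx 0 i) f x.

Fixpoint Ck_on (W : normedModType R) (k : nat) O (f : 'rV[R]_n -> W) : Prop :=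
  (forall x, O x -> {for x, continuous f}) /\
  if k is k'.+1 then
    forall i : 'I_n, (forall x, O x -> derivable f x (delta_mx 0 i)) /\
                     Ck_on k' O (partial i f)
  else True.

(* Intended for open O only: the values of f outside O are then irrelevant. *)
Definition smooth_on (W : normedModType R) O (f : 'rV[R]_n -> W) : Prop :=
  forall k, Ck_on k O f.

Lemma Ck_on_cont (W : normedModType R) k O (f : 'rV[R]_n -> W) x :
  Ck_on k O f -> O x -> {for x, continuous f}.
Proof. by case: k => [|k] [fc _]; exact: fc. Qed.

Lemma Ck_onW (W : normedModType R) k O (f : 'rV[R]_n -> W) :
  Ck_on k.+1 O f -> Ck_on k O f.
Proof.
elim: k f => [f [fc _]|k IH f [fc fd]]; first by split.
by split=> // i; have [di dk] := fd i; split=> //; exact: IH.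
Qed.

Lemma Ck_on_ext (W : normedModType R) k O (f g : 'rV[R]_n -> W) :
  open O -> (forall x, O x -> f x = g x) -> Ck_on k O f -> Ck_on k O g.
Proof.
move=> oO; elim: k f g => [|k IH] f g fg [fc fd];
  have nfg x : O x -> \forall y \near x, f y = g y by
    move=> Ox; apply: filterS (open_nbhs_nbhs (conj oO Ox)) => y; exact: fg.
all: have gc x : O x -> {for x, continuous g} by
    move=> Ox; have := fc _ Ox; rewrite /prop_for /continuous_at -(fg _ Ox);
    apply: cvg_trans; exact: (near_eq_cvg (F := nbhs x) (nfg x Ox)).
all: split=> // i; have [di dk] := fd i; split=> [x Ox|].
  exact: near_eq_derivable (nfg _ Ox) (di _ Ox).
by apply: IH dk => x Ox; exact: near_eq_derive (nfg _ Ox).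
Qed.

Lemma Ck_on_cst (W : normedModType R) k O (w : W) : Ck_on k O (fun=> w).
Proof.
elim: k w => [|k IH] w; split=> //; try by move=> x _; exact: cst_continuous.
move=> i; split=> [x _|]; first exact: derivable_cst.
have -> : partial i (fun=> w) = (fun=> 0); last exact: IH.
by apply/funext => x; rewrite /partial derive_cst.
Qed.

Lemma Ck_onD k O (f g : 'rV[R]_n -> R) : open O ->
  Ck_on k O f -> Ck_on k O g -> Ck_on k O (f + g).
Proof.
move=> oO; elim: k f g => [|k IH] f g fk gk.
  by split=> // x Ox; apply: continuousD;
    [exact: Ck_on_cont fk Ox | exact: Ck_on_cont gk Ox].
split=> [x Ox|i]; first by apply: continuousD;
    [exact: Ck_on_cont fk Ox | exact: Ck_on_cont gk Ox].
have [fd fk'] := fk.2 i; have [gd gk'] := gk.2 i.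
split=> [x Ox|]; first by apply: derivableD; [exact: fd|exact: gd].
apply: (Ck_on_ext (f := partial i f + partial i g)) => //; last exact: IH.
by move=> x Ox; rewrite /partial deriveD //; [exact: fd|exact: gd].
Qed.

Lemma Ck_onM k O (f g : 'rV[R]_n -> R) : open O ->
  Ck_on k O f -> Ck_on k O g -> Ck_on k O (f * g).
Proof.
move=> oO; elim: k f g => [|k IH] f g fk gk.
  by split=> // x Ox; apply: continuousM;
    [exact: Ck_on_cont fk Ox | exact: Ck_on_cont gk Ox].
split=> [x Ox|i]; first by apply: continuousM;
    [exact: Ck_on_cont fk Ox | exact: Ck_on_cont gk Ox].
have [fd fk'] := fk.2 i; have [gd gk'] := gk.2 i.
split=> [x Ox|]; first by apply: derivableM; [exact: fd|exact: gd].
apply: (Ck_on_ext (f := f * partial i g + g * partial i f)) => //.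
  by move=> x Ox; rewrite /partial deriveM //; [exact: fd|exact: gd].
by apply: Ck_onD => //; apply: IH => //; exact: Ck_onW.
Qed.

(* The differential operator of multi-index I. *)
Definition mpartial (I : 'I_n -> nat) (f : 'rV[R]_n -> R) : 'rV[R]_n -> R :=
  foldr (fun i h => iter (I i) (partial i) h) f (enum 'I_n).

End SmoothEuclidean.

Record chart (R : realType) (n : nat) (M : topologicalType) := Chart {
  chart_dom : set M;
  chart_map : M -> 'rV[R]_n;
  chart_inv : 'rV[R]_n -> M;
  chart_open_dom : open chart_dom;
  chart_open_cod : open (chart_map @` chart_dom);
  chart_mapK : forall x, chart_dom x -> chart_inv (chart_map x) = x;
  chart_map_continuous : forall x, chart_dom x -> {for x, continuous chart_map};
  chart_inv_continuous :
    forall y, (chart_map @` chart_dom) y -> {for y, continuous chart_inv}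
}.

Definition chart_cod (R : realType) n (M : topologicalType) (c : chart R n M) :
  set 'rV[R]_n := chart_map c @` chart_dom c.

Record manifold (R : realType) (n : nat) := Manifold {
  mspace :> topologicalType;
  mspace_hausdorff : hausdorff_space mspace;
  mspace_second_countable : @second_countable mspace;
  atlas : set (chart R n mspace);
  atlas_cover : forall x, exists2 c, atlas c & chart_dom c x;
  atlas_smooth : forall c c', atlas c -> atlas c' ->
    smooth_on (chart_map c @` (chart_dom c `&` chart_dom c'))
              (chart_map c' \o chart_inv c)
}.

Arguments atlas {R n} m.

Definition smooth (R : realType) n (M : manifold R n) (f : M -> R) : Prop :=
  forall c, atlas M c -> smooth_on (chart_cod c) (f \o chart_inv c).

Section SmoothFunctions.
Variables (R : realType) (n : nat) (M : manifold R n).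

Definition smooth_pred : {pred M -> R} := fun f => `[<smooth f>].

Lemma smooth_subring : subring_closed smooth_pred.
Proof.
split=> [|f g /asboolP fs /asboolP gs|f g /asboolP fs /asboolP gs].
- by apply/asboolP => c _ k; exact: Ck_on_cst.
- apply/asboolP => c Mc k.
  apply: (Ck_onD (f := f \o chart_inv c) (g := - g \o chart_inv c)).
  + exact: chart_open_cod.
  + exact: fs.
  + apply: (Ck_on_ext (f := (fun=> -1) * (g \o chart_inv c))).
    * exact: chart_open_cod.
    * by move=> x _; rewrite /= -[LHS]/(-1 * g (chart_inv c x)) mulN1r.
    * apply: Ck_onM; [exact: chart_open_cod| exact: Ck_on_cst | exact: gs].
- apply/asboolP => c Mc k.
  apply: (Ck_onM (f := f \o chart_inv c) (g := g \o chart_inv c)).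
  + exact: chart_open_cod.
  + exact: fs.
  + exact: gs.
Qed.

Record Cinf := MkCinf {
  cinf_fun :> M -> R;
  cinf_smooth : cinf_fun \in smooth_pred
}.

HB.instance Definition _ := [isSub for cinf_fun].
HB.instance Definition _ := [Choice of Cinf by <:].
HB.instance Definition _ :=
  GRing.SubChoice_isSubComPzRing.Build (M -> R) smooth_pred Cinf smooth_subring.

Lemma smooth_scale (k : R) (f : Cinf) : (fun x => k * f x) \in smooth_pred.
Proof.
apply/asboolP => c Mc l; have /asboolP fs := cinf_smooth f.
apply: (Ck_onM (f := fun=> k) (g := f \o chart_inv c)).
- exact: chart_open_cod.
- exact: Ck_on_cst.
- exact: fs.
Qed.

Definition cinf_scale (k : R) (f : Cinf) : Cinf := MkCinf (smooth_scale k f).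

Lemma cinf_eq (f g : Cinf) : (forall x, f x = g x) -> f = g.
Proof. by move=> fg; apply/val_inj/funext. Qed.

Lemma cinf_scaleA k l f : cinf_scale k (cinf_scale l f) = cinf_scale (k * l) f.
Proof. by apply: cinf_eq => x /=; rewrite mulrA. Qed.

Lemma cinf_scale1 : left_id 1 cinf_scale.
Proof. by move=> f; apply: cinf_eq => x /=; rewrite mul1r. Qed.

Lemma cinf_scaleDr : right_distributive cinf_scale +%R.
Proof. by move=> k f g; apply: cinf_eq => x /=; rewrite mulrDr. Qed.

Lemma cinf_scaleDl f : {morph cinf_scale^~ f : k l / k + l}.
Proof. by move=> k l; apply: cinf_eq => x /=; rewrite mulrDl. Qed.

HB.instance Definition _ := GRing.Zmodule_isLmodule.Build R Cinf
  cinf_scaleA cinf_scale1 cinf_scaleDr cinf_scaleDl.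

(* In each chart, a sum of products of partial derivatives of the arguments, of
   order at most N in each of them, with smooth coefficients. *)
Definition bidiff_operator (D : Cinf -> Cinf -> Cinf) : Prop :=
  exists N : nat, forall c, atlas M c ->
    exists2 a : {ffun 'I_n -> 'I_N.+1} -> {ffun 'I_n -> 'I_N.+1} ->
                'rV[R]_n -> R,
      forall I J, smooth_on (chart_cod c) (a I J) &
      forall (f g : Cinf) y, chart_cod c y ->
        D f g (chart_inv c y) =
        \sum_(I : {ffun 'I_n -> 'I_N.+1} | (\sum_i I i <= N)%N)
        \sum_(J : {ffun 'I_n -> 'I_N.+1} | (\sum_i J i <= N)%N)
          a I J y * mpartial (fun i => I i : nat) (f \o chart_inv c) y
                  * mpartial (fun i => J i : nat) (g \o chart_inv c) y.

End SmoothFunctions.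

(* Formal power series in hbar with coefficients in A, as coefficient sequences. *)
Notation fps A := (nat -> A) (only parsing).

Section FormalPowerSeries.

Definition fps_const (A : nmodType) (a : A) : fps A :=
  fun n => if n is 0%N then a else 0.

Definition fps_map (A B : Type) (f : A -> B) (u : fps A) : fps B :=
  fun n => f (u n).

(* The hbar-bilinear extension of a biadditive op to power series. *)
Definition cauchy_op (A B : Type) (C : nmodType) (op : A -> B -> C)
    (u : fps A) (v : fps B) : fps C :=
  fun n => \sum_(i < n.+1) op (u i) (v (n - i)%N).

Definition fps_mul (A : pzRingType) : fps A -> fps A -> fps A := cauchy_op *%R.

Definition fps_scale (K : pzRingType) (V : lmodType K) :
  fps K -> fps V -> fps V := cauchy_op *:%R.

(* \sum_k hbar^k u_k for a sequence u of power series *)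
Definition fps_sum (A : nmodType) (u : nat -> fps A) : fps A :=
  fun n => \sum_(k < n.+1) u k (n - k)%N.

End FormalPowerSeries.

Section RMatrix.
Variables (K : comNzRingType) (g : lieAlgType K).
Local Notation U := (env g).
Local Notation UU := (tensor U U).
Local Notation UUU := (tensor U UU).

Definition coproduct : U -> UU :=
  ulift (fun x => tens (ui x) 1 + tens 1 (ui x)).

Definition tflip : UU -> UU := tlift (fun a b => tens b a).

Definition coproduct_opp : U -> UU := tflip \o coproduct.

Definition leg12 : UU -> UUU := tlift (fun a b => tens a (tens b 1)).
Definition leg13 : UU -> UUU := tlift (fun a b => tens a (tens 1 b)).
Definition leg23 : UU -> UUU := tens 1.

Definition id_coproduct : UU -> UUU := tlift (fun a b => tens a (coproduct b)).

(* The value in (U (x) U) (x) U is reassociated into U (x) (U (x) U). *)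
Definition coproduct_id : UU -> UUU :=
  tlift (fun a b => tlift (fun a1 a2 => tens a1 (tens a2 b)) (coproduct a)).

Record universal_Rmatrix (Rm : fps UU) : Prop := UniversalRmatrix {
  Rmatrix0 : Rm 0%N = tens 1 1;
  Rmatrix_conj : exists Rinv : fps UU,
    [/\ fps_mul Rm Rinv = fps_const 1, fps_mul Rinv Rm = fps_const 1 &
        forall a : fps U,
          fps_map coproduct_opp a =
          fps_mul (fps_mul Rm (fps_map coproduct a)) Rinv];
  Rmatrix_id_coproduct :
    fps_map id_coproduct Rm = fps_mul (fps_map leg13 Rm) (fps_map leg12 Rm);
  Rmatrix_coproduct_id :
    fps_map coproduct_id Rm = fps_mul (fps_map leg13 Rm) (fps_map leg23 Rm)
}.

Definition rmatrix (Rm : fps UU) : UU := Rm 1%N.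

End RMatrix.

Section StarProducts.
Variables (R : realType) (n : nat) (M : manifold R n).
Local Notation C := (Cinf M).

Record star_product (star : fps C -> fps C -> fps C) : Prop := StarProduct {
  star_linearl : forall (k : fps R) (f f' h : fps C),
    star (fps_scale k f + f') h = fps_scale k (star f h) + star f' h;
  star_linearr : forall (k : fps R) (f h h' : fps C),
    star f (fps_scale k h + h') = fps_scale k (star f h) + star f h';
  starA : associative star;
  star1l : left_id (fps_const 1) star;
  star1r : right_id (fps_const 1) star;
  star0 : forall f h : C, star (fps_const f) (fps_const h) 0%N = f * h;
  star_bidiff : forall k : nat, (0 < k)%N ->
    bidiff_operator (fun f h : C => star (fps_const f) (fps_const h) k)
}.

(* {f, h} = C_1(f, h) - C_1(h, f) *)
Definition star_bracket (star : fps C -> fps C -> fps C) (f h : C) : C :=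
  star (fps_const f) (fps_const h) 1%N - star (fps_const h) (fps_const f) 1%N.

Definition pointwise_mul : tensor C C -> C := tlift (fun f h : C => f * h).

Variable g : lieAlgType R.
Local Notation U := (env g).

(* Vector fields on M are taken as derivations of C^oo(M). *)
Record derivation_action (X : g -> C -> C) : Prop := DerivationAction {
  derivation_action_rep : lie_rep X;
  derivation_action_leibniz : forall x (f h : C),
    X x (f * h) = X x f * h + f * X x h
}.

(* The action of U(g)[[hbar]] on C^oo(M)[[hbar]] extending X. *)
Definition series_act (X : g -> C -> C) : fps U -> fps C -> fps C :=
  cauchy_op (uact X).

(* The action of U(g) (x) U(g) on C^oo(M) (x) C^oo(M). *)
Definition uact2 (X : g -> C -> C) (t : tensor U U) :
  tensor C C -> tensor C C :=
  tlift (fun f h => tlift (fun a b => tens (uact X a f) (uact X b h)) t).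

(* star f h = star (R_2 |> h) (R_1 |> f): each hbar-coefficient of R lies in the
   algebraic tensor product, where Sweedler's sum is tlift. *)
Definition quasi_commutative_via (star : fps C -> fps C -> fps C)
    (Rm : fps (tensor U U)) (X : g -> C -> C) : Prop :=
  derivation_action X /\
  forall f h : fps C,
    star f h =
    fps_sum (fun k =>
      tlift (fun a b => star (series_act X (fps_const b) h)
                             (series_act X (fps_const a) f)) (Rm k)).

End StarProducts.

(* Main.v *)
Require Import Defs.
From HB Require Import structures.
From mathcomp Require Import all_boot all_order all_algebra.
From mathcomp Require Import all_classical all_reals all_analysis.

(** The statement is the [hbar]-linear part of the quasi-commutativity
    condition.  Write [R = 1 (x) 1 + hbar r + ...] and [*] for the star product,
    with juxtaposition for pointwise multiplication.  For [f], [h] in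
    [C^oo(M)], the coefficient of [hbar] in
    [f * h = (R_2 |> h) * (R_1 |> f)] is
<<
      C_1(f, h) = C_1(h, f) + sum (r_2 |> h) (r_1 |> f),
>>
    because the unit term of [R] contributes the first-order part of [h * f],
    whereas [r] already carries one power of [hbar] and so only meets the
    zeroth-order part of the star product, which is pointwise multiplication.
    Since the latter is commutative, the last sum is [m (r |> (f (x) h))], and
    moving [C_1(h, f)] to the left gives the bracket.

    What remains is to let Sweedler's sums, that is [tlift], commute with the
    linear operations applied to them ([tlift_comp]: extracting an
    [hbar]-coefficient on one side, multiplying pointwise on the other), and to
    see that the maps being lifted are bilinear, so that [tlift] may be
    evaluated on the pure tensors [1 (x) 1] and [f (x) h]. *)

Set Implicit Arguments.
Unset Strict Implicit.
Unset Printing Implicit Defensive.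

Import GRing.Theory.

Local Open Scope ring_scope.

Lemma linear_map0 (K : comNzRingType) (U V : lmodType K) (f : U -> V) :
  linear f -> f 0 = 0.
Proof.
by move=> lf; have := lf 1 0 0; rewrite !scale1r addr0 -{1}[f 0]addr0 => /addrI.
Qed.

(** Both sides evaluate the same representing term of [t], so recursion on that
    term suffices. *)
Lemma tlift_comp (K : comNzRingType) (V W Z Z' : lmodType K) (phi : Z -> Z')
    (b : V -> W -> Z) (t : tensor V W) :
  linear phi -> phi (tlift b t) = tlift (fun v w => phi (b v w)) t.
Proof.
move=> phi_lin.
have phiD x y : phi (x + y) = phi x + phi y.
  by have := phi_lin 1 x y; rewrite !scale1r.
have phi0 := linear_map0 phi_lin.
have phiZ k x : phi (k *: x) = k *: phi x.
  by have := phi_lin k x 0; rewrite phi0 !addr0.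
rewrite /tlift; elim: (repr t) => [|s IHs u IHu|k s IHs|v w] //=.
- by rewrite phiD IHs IHu.
- by rewrite phiZ IHs.
Qed.

Lemma eq_tlift (K : comNzRingType) (V W Z : lmodType K)
    (b b' : V -> W -> Z) (t : tensor V W) :
  b =2 b' -> tlift b t = tlift b' t.
Proof.
by move=> bb'; congr tlift; apply/funext => v; apply/funext => w; exact: bb'.
Qed.

(** This is what makes [uact2] evaluable on pure tensors: the maps that it lifts
    depend on the two functions only through such a parameter. *)
Lemma tlift_linear_param (K : comNzRingType) (P V W Z : lmodType K)
    (b : P -> V -> W -> Z) (t : tensor V W) :
  (forall v w, linear (fun p => b p v w)) -> linear (fun p => tlift (b p) t).
Proof.
move=> b_lin k p q; rewrite /tlift.
elim: (repr t) => [|s IHs u IHu|l s IHs|v w] /=.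
- by rewrite scaler0 addr0.
- by rewrite IHs IHu scalerDr addrACA.
- by rewrite IHs scalerDr !scalerA mulrC.
- exact: b_lin.
Qed.

Lemma cauchy_op_constl (A B : nmodType) (C : nmodType) (op : A -> B -> C) a v :
  (forall y, op 0 y = 0) ->
  cauchy_op op (fps_const a) v = fps_map (op a) v.
Proof.
move=> op0; apply/funext => k; rewrite /cauchy_op big_ord_recl subn0.
by rewrite big1 ?addr0 // => i _; exact: op0.
Qed.

Lemma fps_scale_const (K : pzRingType) (V : lmodType K) (k : K) (u : nat -> V) :
  fps_scale (fps_const k) u = k *: u.
Proof. by rewrite /fps_scale cauchy_op_constl // => y; rewrite scale0r. Qed.

Lemma fps_map_const (A B : nmodType) (f : A -> B) a :
  f 0 = 0 -> fps_map f (fps_const a) = fps_const (f a).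
Proof. by move=> f0; apply/funext => -[|k]. Qed.

Section FirstOrder.
Variables (R : realType) (g : lieAlgType R) (n : nat) (M : manifold R n).
Local Notation C := (Cinf M).
Variable X : g -> C -> C.
Hypothesis X_rep : lie_rep X.

Lemma pointwise_mul_bilin : bilin (fun f h : C => f * h).
Proof.
split=> [h|f] k u v; apply: cinf_eq => x.
  by rewrite -[LHS]/((k * u x + v x) * h x) mulrDl -mulrA.
by rewrite -[LHS]/(f x * (k * u x + v x)) mulrDr mulrCA.
Qed.

Lemma series_act_const (a : env g) (f : C) :
  series_act X (fps_const a) (fps_const f) = fps_const (uact X a f).
Proof.
rewrite /series_act cauchy_op_constl => [|y]; last first.
  exact: (linear_map0 (uact_linearl X_rep y)).
by rewrite fps_map_const //; exact: (linear_map0 (uact_linearr X_rep a)).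
Qed.

Lemma fps_const_linear (V : lmodType R) : linear (@fps_const V).
Proof.
move=> k u v; apply/funext => -[|i] //.
by rewrite -[RHS]/(k *: 0 + 0) scaler0 addr0.
Qed.

(** Bilinearity in [(f, h)] comes from that of [(a |> f) (x) (b |> h)]; the
    product is then pushed inside Sweedler's sum for [t]. *)
Lemma pointwise_mul_uact2 (t : tensor (env g) (env g)) (f h : C) :
  pointwise_mul (uact2 X t (tens f h)) =
  tlift (fun a b => uact X a f * uact X b h) t.
Proof.
rewrite /uact2 tlift_tens; last first.
  have [tl tr] := tens_bilin C C.
  split=> [h'|f'].
    apply: (tlift_linear_param
      (b := fun u a b => tens (uact X a u) (uact X b h'))) => a b k u v.
    by rewrite (uact_linearr X_rep) tl.
  apply: (tlift_linear_param
    (b := fun u a b => tens (uact X a f') (uact X b u))) => a b k u v.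
  by rewrite (uact_linearr X_rep) tr.
rewrite /pointwise_mul (tlift_comp (phi := tlift _)); last first.
  exact/tlift_linear/pointwise_mul_bilin.
by apply: eq_tlift => a b; rewrite tlift_tens //; exact: pointwise_mul_bilin.
Qed.

Variable star : (nat -> C) -> (nat -> C) -> (nat -> C).
Hypothesis star_sp : star_product star.

(** Bilinearity over the ground field is that of the star product, restricted to
    scalars that are constant power series. *)
Lemma star_act_bilin (f h : C) :
  bilin (fun a b : env g =>
    star (fps_const (uact X b h)) (fps_const (uact X a f))).
Proof.
split=> [b|a] k u v; rewrite (uact_linearl X_rep) fps_const_linear.
  by rewrite -fps_scale_const (star_linearr star_sp) fps_scale_const.
by rewrite -fps_scale_const (star_linearl star_sp) fps_scale_const.
Qed.

Lemma quasi_commutative_const (Rm : nat -> tensor (env g) (env g)) (f h : C) :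
  quasi_commutative_via star Rm X ->
  star (fps_const f) (fps_const h) =
  fps_sum (fun k => tlift (fun a b =>
    star (fps_const (uact X b h)) (fps_const (uact X a f))) (Rm k)).
Proof.
move=> [_ ->]; congr fps_sum; apply/funext => k.
by apply: eq_tlift => a b; rewrite !series_act_const.
Qed.

(** Comparing coefficients of [hbar] in the quasi-commutativity condition: the
    unit term of [Rm] yields the first-order part of the opposite product, and
    the next term meets only pointwise multiplication. *)
Lemma quasi_commutative1 (Rm : nat -> tensor (env g) (env g)) (f h : C) :
  quasi_commutative_via star Rm X -> Rm 0%N = tens 1 1 ->
  star (fps_const f) (fps_const h) 1%N =
  star (fps_const h) (fps_const f) 1%N +
  tlift (fun a b => uact X a f * uact X b h) (Rm 1%N).
Proof.
move=> qc Rm0; rewrite (quasi_commutative_const f h qc) /fps_sum.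
rewrite !big_ord_recl big_ord0 addr0 /= Rm0 tlift_tens; last first.
  exact: star_act_bilin.
rewrite !(uact1 X_rep); congr (_ + _).
(* the factor hbar of the r-matrix leaves the zeroth coefficient *)
rewrite (tlift_comp (phi := fun u : nat -> C => u 0%N)) //.
by apply: eq_tlift => a b; rewrite (star0 star_sp) mulrC.
Qed.

End FirstOrder.

Theorem proposition2p10 (R : realType) (g : fdLieAlgType R)
    (Rm : fps (tensor (env g) (env g))) (hR : universal_Rmatrix Rm)
    (n : nat) (M : manifold R n)
    (star : fps (Cinf M) -> fps (Cinf M) -> fps (Cinf M))
    (hstar : star_product star)
    (X : g -> Cinf M -> Cinf M) (hX : quasi_commutative_via star Rm X) :
  forall f h : Cinf M,
    star_bracket star f h = pointwise_mul (uact2 X (rmatrix Rm) (tens f h)).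
Proof.
move=> f h; have X_rep := derivation_action_rep hX.1.
rewrite pointwise_mul_uact2 // /star_bracket /rmatrix.
by rewrite (quasi_commutative1 X_rep hstar f h hX (Rmatrix0 hR)) addrC addKr.
Qed.
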